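(* Let $0<\alpha<d$, $1<p<d/\alpha$, and define $\frac1{p_\alpha}=\frac1p-\frac\alpha d$, $t=\frac d\alpha$. Let $w\in A_{p,p_\alpha}$, and let $b$ be a real-valued locally integrable function on $\mathbb R^d$. Suppose that there exists $C_0>0$ such that $$\|[b,I_\alpha]f\|_{L^p((wv)^p)}\le C_0\,\|v\|_{L^{t,\infty}}\,\|f\|_{L^p(w^p)}$$ for every nonnegative $v\in L^{t,\infty}(\mathbb R^d)$ and every bounded compactly supported function $f$. Then $b\in\mathrm{BMO}(\mathbb R^d)$, and $$\|b\|_{\mathrm{BMO}}\le C\,C_0,$$ where $C$ depends only on $d,\alpha,p$ and $[w]_{A_{p,p_\alpha}}$.
   Context: A weight is a measurable function on $\mathbb R^d$ with values in $(0,\infty)$ almost everywhere; cubes $Q$ have sides parallel to the axes. $\|g\|_{L^{t,\infty}}:=\sup_{\tau>0}\tau^{1/t}g^*(\tau)$ with $g^*$ the decreasing rearrangement of $g$. $\|g\|_{L^p(W)}:=\big(\int_{\mathbb R^d}|g|^pW\,dx\big)^{1/p}$. A weight $w$ belongs to $A_{p,q}$ if $[w]_{A_{p,q}}:=\sup_Q\big(\frac1{|Q|}\int_Qw^q\big)^{1/q}\big(\frac1{|Q|}\int_Qw^{-p'}\big)^{1/p'}<\infty$, where $p'$ is the conjugate exponent. $I_\alpha f(x)=\int_{\mathbb R^d}\frac{f(y)}{|x-y|^{d-\alpha}}dy$ and $[b,I_\alpha]f:=bI_\alpha f-I_\alpha(bf)$. $\|b\|_{\mathrm{BMO}}:=\sup_Q\frac1{|Q|}\int_Q|b-\langle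 b\rangle_Q|$ with $\langle b\rangle_Q=\frac1{|Q|}\int_Qb$, and $\mathrm{BMO}$ is the space of locally integrable $b$ for which this is finite. *)

(* Defs.v *)
From HB Require Import structures.
From mathcomp Require Import all_boot all_order all_algebra.
From mathcomp Require Import all_classical all_reals all_analysis.

Set Implicit Arguments.
Unset Strict Implicit.
Unset Printing Implicit Defensive.
Import Order.TTheory GRing.Theory Num.Theory.
Import numFieldNormedType.Exports.

Local Open Scope classical_set_scope.
Local Open Scope ring_scope.

(* The library has no Lebesgue measure on 'rV[R]_n. It is built here in two
   steps: the n-fold product of the one-dimensional Lebesgue measure on the
   Borel sets ([borel_rV], [borel_leb]), then its completion, so that
   "measurable" on [euclid] means Lebesgue measurable. *)
Definition borel_rV (R : realType) (n : nat) : Type := 'rV[R]_n.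

Definition borel_rV_display : measure_display.
Proof. exact: default_measure_display. Qed.

Section borel_rV.
Variables (R : realType) (n : nat).

HB.instance Definition _ := Pointed.copy (borel_rV R n) 'rV[R]_n.

Definition rV_coor (i : 'I_n) (x : borel_rV R n) : measurableTypeR R :=
  x ord0 i.

Let borel_rV_set0 : g_sigma_preimage rV_coor set0.
Proof. exact: sigma_algebra0. Qed.

Let borel_rV_setC A : g_sigma_preimage rV_coor A ->
  g_sigma_preimage rV_coor (~` A).
Proof. exact: sigma_algebraC. Qed.

Let borel_rV_bigcup (F : (set (borel_rV R n))^nat) :
  (forall i, g_sigma_preimage rV_coor (F i)) ->
  g_sigma_preimage rV_coor (\bigcup_i (F i)).
Proof. exact: sigma_algebra_bigcup. Qed.

HB.instance Definition _ := @isMeasurable.Build borel_rV_display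
  (borel_rV R n) (g_sigma_preimage rV_coor)
  borel_rV_set0 borel_rV_setC borel_rV_bigcup.

Lemma measurable_rV_coor (i : 'I_n) : measurable_fun setT (rV_coor i).
Proof.
move=> _ Y mY; rewrite setTI; apply: sub_sigma_algebra => /=.
rewrite -bigcup_seq/=; exists i => /=; first by rewrite mem_index_enum.
by exists Y => //; rewrite setTI.
Qed.

Lemma measurable_fun_rV d (T : measurableType d) (f : T -> borel_rV R n) :
  (forall i, measurable_fun setT (rV_coor i \o f)) -> measurable_fun setT f.
Proof.
move=> mf; suff fM : g_sigma_preimage (fun i => rV_coor i \o f) `<=` measurable.
  move=> _ A mA; apply: fM; rewrite g_sigma_preimage_comp.
  by exists A.
apply: smallest_sub; first exact: sigma_algebra_measurable.
move=> A; rewrite -bigcup_seq => -[i _ [B mB <-]]; exact: mf.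
Qed.

End borel_rV.

Section borel_leb_step.
Variables (R : realType) (n : nat).

Definition rV_cons (u : measurableTypeR R * borel_rV R n) : borel_rV R n.+1 :=
  \row_i oapp (fun j => u.2 ord0 j) u.1 (unlift ord0 i).

Let rV_uncons (x : borel_rV R n.+1) : measurableTypeR R * borel_rV R n :=
  (x ord0 ord0, \row_j x ord0 (lift ord0 j)).

Let rV_consK : cancel rV_cons rV_uncons.
Proof.
case=> a v; rewrite /rV_uncons /rV_cons mxE unlift_none /=; congr (_, _).
by apply/rowP => j; rewrite !mxE liftK.
Qed.

Lemma measurable_rV_cons : measurable_fun setT rV_cons.
Proof.
apply: measurable_fun_rV => i.
case: (unliftP ord0 i) => [j|] ij.
- rewrite (_ : _ \o _ = rV_coor j \o snd).
    by apply: measurableT_comp => //; exact: measurable_rV_coor.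
  by apply/funext => u /=; rewrite /rV_coor mxE ij liftK.
- rewrite (_ : _ \o _ = fst); first exact: measurable_fst.
  by apply/funext => u /=; rewrite /rV_coor mxE ij unlift_none.
Qed.

Let measurable_rV_uncons : measurable_fun setT rV_uncons.
Proof.
apply/measurable_fun_pairP; split; first exact: (measurable_rV_coor ord0).
apply: measurable_fun_rV => i.
rewrite (_ : _ \o _ = rV_coor (lift ord0 i)); first exact: measurable_rV_coor.
by apply/funext => u /=; rewrite /rV_coor mxE.
Qed.

Variable m : {sigma_finite_measure set (borel_rV R n) -> \bar R}.

Definition borel_leb_step : set (borel_rV R n.+1) -> \bar R :=
  pushforward (@lebesgue_measure R \x m)%E rV_cons.

Let step_measure : {measure set (borel_rV R n.+1) -> \bar R} :=
  measure_function_pushforward__canonical__measure_function_Measure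
    (@lebesgue_measure R \x m)%E measurable_rV_cons.

HB.instance Definition _ := isMeasure.Build _ _ _ borel_leb_step
  (measure0 step_measure) (measure_ge0 step_measure)
  (@measure_semi_sigma_additive _ _ _ step_measure).

Let borel_leb_step_sigma_finite : sigma_finite setT borel_leb_step.
Proof.
have /sigma_finiteP[F [TF ndF Foo]] := sigma_finiteT (@lebesgue_measure R).
have /sigma_finiteP[G [TG ndG Goo]] := sigma_finiteT m.
exists (fun k => rV_uncons @^-1` (F k `*` G k)).
  rewrite -preimage_bigcup (_ : \bigcup_k _ = setT) ?preimage_setT//.
  apply/seteqP; split=> // -[x y] _.
  have [i _ Fx] : (\bigcup_k F k) x by rewrite -TF.
  have [j _ Gy] : (\bigcup_k G k) y by rewrite -TG.
  exists (maxn i j) => //; split => /=.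
  - by move: x Fx; exact/subsetPset/ndF/leq_maxl.
  - by move: y Gy; exact/subsetPset/ndG/leq_maxr.
move=> k; have [mF Fk] := Foo k; have [mG Gk] := Goo k; split.
  rewrite -[X in measurable X]setTI; apply: measurable_rV_uncons => //.
  exact: measurableX.
rewrite /borel_leb_step /pushforward -comp_preimage.
rewrite (_ : _ \o _ = id); last by apply/funext => u /=; exact: rV_consK.
by rewrite preimage_id product_measure1E// lte_mul_pinfty// ge0_fin_numE.
Qed.

HB.instance Definition _ := Measure_isSigmaFinite.Build _ _ _ borel_leb_step
  borel_leb_step_sigma_finite.

End borel_leb_step.

Fixpoint borel_leb (R : realType) (n : nat) :
    {sigma_finite_measure set (borel_rV R n) -> \bar R} :=
  match n with
  | 0 => @dirac _ (borel_rV R 0) 0 R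
  | n'.+1 => borel_leb_step (borel_leb R n')
  end.

Section box.
Variable R : realType.

Lemma measurable_box n (A : 'I_n -> set (measurableTypeR R)) :
  (forall i, measurable (A i)) ->
  measurable ([set x | forall i, A i (x ord0 i)] : set (borel_rV R n)).
Proof.
move=> mA.
have -> : ([set x | forall i, A i (x ord0 i)] : set (borel_rV R n)) =
    \big[setI/setT]_(i < n) (@rV_coor R n i @^-1` A i).
  rewrite -bigcap_seq; apply/seteqP; split => x /=.
    by move=> H i _; exact: H.
  by move=> H i; apply: H; rewrite /= mem_index_enum.
apply: bigsetI_measurable => i _; rewrite -[X in measurable X]setTI.
exact: measurable_rV_coor.
Qed.

Lemma borel_leb_box n (A : 'I_n -> set (measurableTypeR R)) :
  (forall i, measurable (A i)) ->
  borel_leb R n [set x | forall i, A i (x ord0 i)] =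
  (\prod_(i < n) lebesgue_measure (A i))%E.
Proof.
elim: n A => [|n IH] A mA.
  by rewrite big_ord0 /= /dirac indicE mem_set//= => -[].
pose A' i := A (lift ord0 i).
have mA' i : measurable (A' i) by exact: mA.
rewrite /= /borel_leb_step /pushforward.
have E : @rV_cons R n @^-1` [set x | forall i, A i (x ord0 i)] =
    A ord0 `*` [set x : borel_rV R n | forall i, A' i (x ord0 i)].
  apply/seteqP; split => -[x y] /=.
    move=> H; split; first by have := H ord0; rewrite /rV_cons mxE unlift_none.
    by move=> i; have := H (lift ord0 i); rewrite mxE liftK.
  by move=> [Ax H] i; rewrite mxE; case: unliftP => [j|] ->/=; [exact: H|].
transitivity ((@lebesgue_measure R \x borel_leb R n)%E
  (A ord0 `*` [set x : borel_rV R n | forall i, A' i (x ord0 i)])).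
  by rewrite -E.
rewrite product_measure1E//; last by have := @measurable_box n A' mA'.
by rewrite big_ord_recl -(IH A' mA').
Qed.

End box.

Definition euclid (R : realType) (d : nat) : Type := 'rV[R]_d.

Section euclid.
Variables (R : realType) (d : nat).

HB.instance Definition _ := PointedTopological.copy (euclid R d) 'rV[R]_d.

HB.instance Definition _ := Measurable.copy (euclid R d)
  (caratheodory_type (borel_leb R d)^*%mu).

Definition leb : set (euclid R d) -> \bar R :=
  @completed_measure_extension _ (borel_rV R d) R (borel_leb R d).

HB.instance Definition _ := Measure.copy leb
  (@completed_measure_extension _ (borel_rV R d) R (borel_leb R d)).

Let leb_sigma_finite : sigma_finite setT leb.
Proof.
exact/completed_measure_extension_sigma_finite/sigma_finiteT.
Qed.

HB.instance Definition _ := Measure_isSigmaFinite.Build _ _ _ leb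
  leb_sigma_finite.

Lemma leb_cube (a : 'rV[R]_d) (l : R) : 0 < l ->
  let Q := [set x : euclid R d | forall i, a ord0 i <= x ord0 i <= a ord0 i + l]
  in measurable Q /\ leb Q = (l ^+ d)%:E.
Proof.
move=> l0 Q.
pose I (i : 'I_d) : set (measurableTypeR R) := `[a ord0 i, a ord0 i + l]%classic.
have mI i : measurable (I i) by exact: measurable_itv.
have QE : Q = [set x | forall i, I i (x ord0 i)].
  by apply/seteqP; split => x /= H i; have := H i; rewrite /I/= in_itv.
have mQ : measurable (Q : set (borel_rV R d)).
  by rewrite QE; have := measurable_box mI.
split.
  change ((borel_leb R d)^*%mu.-cara.-measurable Q).
  apply: (@sub_caratheodory _ (borel_rV R d) R (borel_leb R d)).
  by apply: sub_sigma_algebra; exact: mQ.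
transitivity (borel_leb R d (Q : set (borel_rV R d))).
  by rewrite /leb /completed_measure_extension /= measurable_mu_extE.
rewrite QE; have /= -> := borel_leb_box mI.
transitivity (\prod_(i < d) l%:E)%E; last by rewrite prodEFin prodr_const card_ord.
apply: eq_bigr => i _.
by rewrite lebesgue_measure_itv /= lte_fin ltrDl l0 -EFinD addrAC subrr add0r.
Qed.

End euclid.
Arguments leb {R d}.

Section function_classes.
Variables (R : realType) (d : nat).
Local Open Scope ereal_scope.
Implicit Types (Q : set (euclid R d)) (w b f g v : euclid R d -> R) (p q t : R).

Definition eucl_dist (x y : euclid R d) : R :=
  Num.sqrt (\sum_(i < d) (x ord0 i - y ord0 i) ^+ 2)%R.

Definition cube Q : Prop := exists (a : euclid R d) (l : R), (0 < l)%R /\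
  Q = [set x | forall i, (a ord0 i <= x ord0 i <= a ord0 i + l)%R].

Definition avg Q (f : euclid R d -> \bar R) : \bar R :=
  ((fine (leb Q))^-1)%:E * \int[leb]_(x in Q) f x.

Definition weight w : Prop :=
  measurable_fun setT w /\ {ae leb, forall x, (0 < w x)%R}.

Definition Apq_const p q w : \bar R :=
  let p' := (p / (p - 1))%R in
  ereal_sup [set avg Q (fun x => (w x `^ q)%:E) `^ q^-1 *
                 avg Q (fun x => (w x `^ (- p'))%:E) `^ p'^-1 | Q in cube].

Definition Apq p q w : Prop := weight w /\ Apq_const p q w < +oo.

Definition loc_integrable b : Prop := measurable_fun setT b /\
  forall K : set (euclid R d), compact K -> \int[leb]_(x in K) `|b x|%:E < +oo.

Definition bmo_norm b : \bar R :=
  ereal_sup [set avg Q (fun x => `|b x - fine (avg Q (EFin \o b))|%:E)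
            | Q in cube].

Definition bmo b : Prop := loc_integrable b /\ bmo_norm b < +oo.

Definition rearrangement g (tau : R) : \bar R :=
  ereal_inf [set s%:E | s in
    [set s | (0 <= s)%R /\ leb [set x | (s < `|g x|)%R] <= tau%:E]].

Definition weakL_norm t g : \bar R :=
  ereal_sup [set (tau `^ t^-1)%:E * rearrangement g tau
            | tau in [set tau | (0 < tau)%R]].

Definition weakL t g : Prop := measurable_fun setT g /\ weakL_norm t g < +oo.

Definition weighted_norm p w (g : euclid R d -> \bar R) : \bar R :=
  (\int[leb]_x (`|g x| `^ p * (w x)%:E)) `^ p^-1.

Definition bounded_compactly_supported f : Prop :=
  [/\ measurable_fun setT f, (exists M, forall x, (`|f x| <= M)%R) &
      compact (closure [set x | f x != 0%R])].

(* The integrand is 0 at y = x, since 0 `^ s = 0 for s != 0 and 0^-1 = 0; this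
   only concerns a null set. *)
Definition riesz (alpha : R) f (x : euclid R d) : \bar R :=
  \int[leb]_y (f y / eucl_dist x y `^ (d%:R - alpha))%:E.

Definition riesz_commutator (alpha : R) b f (x : euclid R d) : \bar R :=
  (b x)%:E * riesz alpha f x - riesz alpha (fun y => b y * f y)%R x.

End function_classes.

(* Main.v *)
Require Import Defs.
From mathcomp Require Import all_boot all_order all_algebra.
From mathcomp Require Import all_classical all_reals all_analysis.
From mathcomp Require Import measurable_realfun ring lra.

Set Implicit Arguments.
Unset Strict Implicit.
Unset Printing Implicit Defensive.
Import Order.TTheory GRing.Theory Num.Theory.
Import numFieldNormedType.Exports.
Local Open Scope classical_set_scope.
Local Open Scope ring_scope.

(* Let c be the mean of b over a cube Q of side l. One of the sets
   {x in Q | b x <= c} and {x in Q | c <= b x}, say G, has measure at least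
   |Q| / 2. On Q \ G the difference b x - b y has constant sign for y in G and
   modulus at least |b x - c|, while |x - y| <= sqrt d * l, so the commutator
   applied to the indicator of G is bounded below there by a multiple of
   l ^ alpha * |b x - c|. Testing the hypothesis with this indicator and with v
   the indicator of Q, whose weak norm is l ^ alpha, bounds the L^p(w^p) norm of
   (b - c) on Q \ G; Hoelder's inequality, Jensen's inequality (p < p_alpha) and
   the A_{p, p_alpha} condition turn this into a bound of the integral of |b - c|
   over Q \ G. As b - c has mean zero, this is half of its integral over Q. *)

(** * Monotonicity of extended powers and integrals *)

Lemma lee_poweR (R : realType) (r : R) (x y : \bar R) :
  0 <= r -> (0 <= x)%E -> (x <= y)%E -> (x `^ r <= y `^ r)%E.
Proof.
move=> r0 x0 xy; apply: gt0_ler_poweR => //.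
- by rewrite in_itv /= x0 leey.
- by rewrite in_itv /= (le_trans x0 xy) leey.
Qed.

(* The right-hand function need not be measurable, unlike in
   [ge0_le_integral]; this spares the measurability of the commutator. *)
Lemma ge0_integral_mono d (T : measurableType d) (R : realType)
    (mu : {measure set T -> \bar R}) (f g : T -> \bar R) :
  (forall x, (0 <= f x)%E) -> (forall x, (f x <= g x)%E) ->
  (\int[mu]_x f x <= \int[mu]_x g x)%E.
Proof.
move=> f0 fg; have g0 x : (0 <= g x)%E by exact: le_trans (fg x).
rewrite !ge0_integralTE//=; apply: ereal_sup_le => _ /= [h hf <-].
by exists h => // x; exact: le_trans (fg x).
Qed.

(** As [g] keeps one sign, the modulus passes under the integral, even when the integral is
    infinite. *)
Lemma ge0_le_integral_abs d (T : measurableType d) (R : realType)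
    (mu : {measure set T -> \bar R}) (f g : T -> R) :
  measurable_fun setT f -> measurable_fun setT g -> (forall x, 0 <= f x) ->
  (forall x, 0 <= g x) \/ (forall x, g x <= 0) ->
  {ae mu, forall x, f x <= `|g x|} ->
  (\int[mu]_x (f x)%:E <= `|\int[mu]_x (g x)%:E|)%E.
Proof.
move=> mf mg f0 sg fg.
have -> : (`|\int[mu]_x (g x)%:E| = \int[mu]_x (`|g x|)%:E)%E.
  have absge0 : (0 <= \int[mu]_x (`|g x|)%:E)%E.
    by apply: integral_ge0 => x _; rewrite lee_fin.
  rewrite -(gee0_abs absge0); case: sg => g0.
    by congr (`| _ |)%E; apply: eq_integral => x _; rewrite ger0_norm.
  rewrite -[RHS]abseN; congr (`| _ |)%E; rewrite -integral_ge0N//.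
  by apply: eq_integral => x _; rewrite ler0_norm// EFinN oppeK.
apply: ae_ge0_le_integral => //.
- by move=> x _; rewrite lee_fin.
- exact/measurable_EFinP.
- apply/measurable_EFinP; exact: measurableT_comp.
- by apply: filterS fg => x fgx _; rewrite lee_fin.
Qed.

(** * Topology, measurability and distances in the Euclidean space *)

Section euclid_facts.
Variables (R : realType) (d : nat).
Implicit Types (Q : set (euclid R d)).

Lemma measurable_euclid_coor (i : 'I_d) :
  measurable_fun setT (fun x : euclid R d => x ord0 i : R).
Proof.
move=> _ Y mY; rewrite setTI.
apply: (@sub_caratheodory _ (borel_rV R d) R (borel_leb R d)).
apply: sub_sigma_algebra.
by have := measurable_rV_coor i measurableT mY; rewrite setTI.
Qed.

Lemma measurable_eucl_dist (x : euclid R d) : measurable_fun setT (eucl_dist x).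
Proof.
rewrite (_ : eucl_dist x = fun y =>
    (\sum_(i < d) (x ord0 i - y ord0 i) ^+ 2) `^ 2^-1); last first.
  apply/funext => y; rewrite powR12_sqrt//.
  by apply: sumr_ge0 => i _; exact: sqr_ge0.
apply: (measurableT_comp (measurable_powR _)).
apply: measurable_sum => i; apply: measurable_funX.
apply: measurable_funB; first exact: measurable_cst.
exact: measurable_euclid_coor.
Qed.

(** A singleton is a degenerate box, and for [0 < d] the product giving its measure contains a null
    factor. *)
Lemma ae_neq (x : euclid R d) :
  (0 < d)%N -> {ae (@leb R d), forall y, y <> x}.
Proof.
move=> d0; pose A (i : 'I_d) : set (measurableTypeR R) := [set x ord0 i].
have mA i : measurable (A i) by exact: measurable_set1.
have xE : [set x] = [set y | forall i, A i (y ord0 i)].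
  apply/seteqP; split => [_ -> //|y /= yx].
  by apply/rowP => i; exact: yx.
have mx : measurable ([set x] : set (borel_rV R d)).
  by rewrite xE; have := measurable_box mA.
exists [set x]; split => /=; last by move=> y /= /contrapT ->.
  apply: (@sub_caratheodory _ (borel_rV R d) R (borel_leb R d)).
  exact: sub_sigma_algebra.
transitivity (borel_leb R d ([set x] : set (borel_rV R d))).
  by rewrite /leb /completed_measure_extension /= measurable_mu_extE.
rewrite xE; have /= -> := borel_leb_box mA.
rewrite (bigD1 (Ordinal d0))//=.
by rewrite (_ : lebesgue_measure _ = 0%E) ?mul0e// lebesgue_measure_set1.
Qed.

Lemma compact_cube Q : cube Q -> compact Q.
Proof.
move=> [a [l [_ ->]]].
have := @rV_compact R d (fun i => `[a ord0 i, a ord0 i + l]%classic)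
  (fun i => @segment_compact R _ _).
congr compact; apply/seteqP; split => x /= xQ i; have := xQ i; rewrite in_itv.
Qed.

Lemma closed_cube Q : cube Q -> closed Q.
Proof.
move=> cQ; have hE : hausdorff_space (euclid R d).
  exact: (@norm_hausdorff R 'rV[R]_d).
exact: compact_closed hE (compact_cube cQ).
Qed.

Lemma eucl_dist_gt0 (x y : euclid R d) : x <> y -> 0 < eucl_dist x y.
Proof.
move=> xy; rewrite sqrtr_gt0 lt_neqAle eq_sym sumr_ge0 ?andbT; last first.
  by move=> i _; exact: sqr_ge0.
apply/eqP => /psumr_eq0P.
have h (i : 'I_d) : true -> 0 <= (x ord0 i - y ord0 i) ^+ 2.
  by move=> _; exact: sqr_ge0.
move=> /(_ (fun i => h i)) xy0; apply: xy; apply/rowP => i.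
by apply/eqP; rewrite -subr_eq0 -sqrf_eq0 xy0.
Qed.

Lemma eucl_dist_cube (a : euclid R d) (l : R) (x y : euclid R d) : 0 <= l ->
  (forall i, a ord0 i <= x ord0 i <= a ord0 i + l) ->
  (forall i, a ord0 i <= y ord0 i <= a ord0 i + l) ->
  eucl_dist x y <= Num.sqrt d%:R * l.
Proof.
move=> l0 xQ yQ; rewrite -[l in leRHS](ger0_norm l0) -sqrtr_sqr -sqrtrM//.
apply: ler_wsqrtr; rewrite mulr_natl -[d in leRHS]card_ord -sumr_const.
apply: ler_sum => i _; rewrite -real_normK ?num_real// lerXn2r ?nnegrE//.
have /andP[? ?] := xQ i; have /andP[? ?] := yQ i.
by rewrite ler_norml; apply/andP; split; lra.
Qed.

End euclid_facts.

(** * Weak Lebesgue norms *)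

Lemma weakL_norm_ge0 (R : realType) (d : nat) (t : R) (g : euclid R d -> R) :
  (0 <= weakL_norm t g)%E.
Proof.
apply: (@le_trans _ _ ((1 `^ t^-1)%:E * rearrangement g 1)%E); last first.
  by apply: ereal_sup_ubound; exists 1 => //=.
rewrite powR1 mul1e; apply: le_ereal_inf_tmp => _ /= [s [s0 _] <-].
by rewrite lee_fin.
Qed.

(** The rearrangement of [\1_A] is at most 1 everywhere and vanishes from [leb A] on, so only
    smaller [tau] contribute to the supremum. *)
Lemma weakL_norm_indic (R : realType) (d : nat) (t : R) (A : set (euclid R d)) :
  0 < t -> (weakL_norm t \1_A <= leb A `^ t^-1)%E.
Proof.
move=> t0; apply: ge_ereal_sup => _ [tau /= tau0 <-].
have tau0' : (0 <= (tau `^ t^-1)%:E)%E by rewrite lee_fin powR_ge0.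
have [Atau|tauA] := leP (leb A) tau%:E.
  suff r0 : (rearrangement (\1_A : euclid R d -> R) tau <= 0)%E.
    apply: (@le_trans _ _ 0%E); last exact: poweR_ge0.
    by rewrite -(mule0 (tau `^ t^-1)%:E) lee_wpmul2l.
  apply: ereal_inf_lbound; exists 0 => //; split => //.
  rewrite (_ : [set x | _] = A)//; apply/seteqP; split => x /=.
    rewrite indicE; case: (boolP (x \in A)) => [/set_mem//|_].
    by rewrite normr0 ltxx.
  by move=> Ax; rewrite indicE mem_set// normr1.
have r1 : (rearrangement (\1_A : euclid R d -> R) tau <= 1)%E.
  apply: ereal_inf_lbound; exists 1 => //; split => //.
  rewrite (_ : [set x | _] = set0) ?measure0 ?lee_fin 1?ltW//.
  apply/seteqP; split => x //=.
  by rewrite indicE; case: (x \in A); rewrite ?normr1 ?normr0 ?ltxx// ltr10.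
apply: (@le_trans _ _ (tau `^ t^-1)%:E).
  by rewrite -[leRHS]mule1 lee_wpmul2l.
rewrite -poweR_EFin lee_poweR ?lee_fin ?invr_ge0 1?ltW//.
Qed.

(** * Pointwise lower bound for the commutator of an indicator *)

Section commutator_lower_bound.
Variables (R : realType) (d : nat) (alpha : R).
Variables (a : euclid R d) (l : R).
Hypotheses (d0 : (0 < d)%N) (alphad : alpha < d%:R) (l0 : 0 < l).

Let Q := [set x : euclid R d | forall i, a ord0 i <= x ord0 i <= a ord0 i + l].
Let ker (x y : euclid R d) : R := (eucl_dist x y `^ (d%:R - alpha))^-1.
(** Lower bound of the kernel on Q x Q off the diagonal, as [Num.sqrt d%:R * l] bounds the diameter
    of Q. *)
Let kappa : R := ((Num.sqrt d%:R * l) `^ (d%:R - alpha))^-1.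

Let ker_ge0 x y : 0 <= ker x y.
Proof. by rewrite invr_ge0 powR_ge0. Qed.

Let measurable_ker x : measurable_fun setT (ker x).
Proof.
rewrite (_ : ker x = fun y => eucl_dist x y `^ (- (d%:R - alpha))); last first.
  by apply/funext => y; rewrite powRN.
apply: (measurableT_comp (measurable_powR _)).
exact: measurable_eucl_dist.
Qed.

Let ker_ge x y : Q x -> Q y -> x <> y -> kappa <= ker x y.
Proof.
move=> Qx Qy xy; have dxy := eucl_dist_gt0 xy.
have dle : eucl_dist x y <= Num.sqrt d%:R * l.
  by apply: eucl_dist_cube Qx Qy; exact: ltW.
rewrite lef_pV2 ?posrE ?powR_gt0//; last exact: lt_le_trans dle.
apply: ge0_ler_powR => //; rewrite ?nnegrE ?subr_ge0 ltW//.
exact: lt_le_trans dle.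
Qed.

Variables (b : euclid R d -> R) (G : set (euclid R d)) (m : R).
Hypotheses (mb : measurable_fun setT b) (mG : measurable G) (GQ : G `<=` Q).

(** The level [m] separates [b x] from the values of [b] on [G], so [b x - b y] keeps its sign for y
    in [G] and has modulus at least [|b x - m|]: nothing cancels in the integral. *)
Lemma riesz_commutator_ge (x : euclid R d) : Q x ->
  (forall y, G y -> b y <= m <= b x) \/ (forall y, G y -> b x <= m <= b y) ->
  ((kappa * `|b x - m|)%:E * leb G <= `|riesz_commutator alpha b \1_G x|)%E.
Proof.
move=> Qx bm.
pose c := kappa * `|b x - m|.
have kappa0 : 0 <= kappa by rewrite invr_ge0 powR_ge0.
(* A general [g] serves two cases: [b x - b y] when both Riesz terms are finite, and [b] itself when
   the first is infinite and [b x = 0]. *)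
have sepE (g : euclid R d -> R) : measurable_fun setT g ->
    (forall y, G y -> g y <= 0) \/ (forall y, G y -> 0 <= g y) ->
    (forall y, G y -> `|b x - m| <= `|g y|) ->
    (c%:E * leb G <= `|\int[leb]_y (g y * \1_G y * ker x y)%:E|)%E.
  move=> mg sg cg; have mG1 : measurable_fun setT (\1_G : euclid R d -> R).
    exact: measurable_indic.
  have -> : (c%:E * leb G = \int[leb]_y (c * \1_G y)%:E)%E.
    under eq_integral do rewrite EFinM.
    rewrite ge0_integralZl_EFin; [|exact: measurableT| | |].
    - by rewrite integral_indic ?setIT//; exact: measurableT.
    - by move=> y _; rewrite lee_fin.
    - exact/measurable_EFinP.
    - by rewrite /c mulr_ge0.
  apply: ge0_le_integral_abs.
  - exact: measurable_funM.
  - by apply: measurable_funM; [exact: measurable_funM|exact: measurable_ker].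
  - by move=> y; rewrite !mulr_ge0.
  - case: sg => sg; [right|left] => y; rewrite indicE;
      have [/set_mem Gy|_] := boolP (y \in G); rewrite ?mulr0 ?mul0r// mulr1.
    + by rewrite mulr_le0_ge0// sg.
    + by rewrite mulr_ge0// sg.
  (* At y = x the kernel has the default value 0, which is below [kappa]; this point is discarded as
     a null set. *)
  - apply: filterS (@ae_neq R d x d0) => y yx; rewrite indicE.
    have [/set_mem Gy|_] := boolP (y \in G); last by rewrite !(mulr0, mul0r) normr0.
    rewrite !mulr1 normrM (ger0_norm (ker_ge0 _ _)) /c mulrC ler_pM//.
    + exact: cg.
    + by apply: ker_ge => //; [exact: GQ|exact/nesym].
(* No integrability of the kernel is needed: as [+oo - +oo = -oo], the commutator
   has infinite modulus as soon as one of its two terms is infinite. *)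
rewrite /riesz_commutator /riesz.
have mG1 : measurable_fun setT (\1_G : euclid R d -> R).
  exact: measurable_indic.
have mA : measurable_fun setT (fun y => \1_G y * ker x y).
  exact: measurable_funM.
have mB : measurable_fun setT (fun y => b y * \1_G y * ker x y).
  by apply: measurable_funM; [exact: measurable_funM|exact: measurable_ker].
set A := (\int[leb]_y _)%E; set B := (\int[leb]_y _)%E.
have A0 : (0 <= A)%E.
  by apply: integral_ge0 => y _; rewrite lee_fin; apply: mulr_ge0 (ker_ge0 x y).
have [Afin|Ainf] := boolP (A \is a fin_num); last first.
  have {A0 Ainf} -> : A = +oo%E by case: A A0 Ainf => [r| |].
  have [bx0|bx0] := eqVneq (b x) 0; last first.
    by rewrite mulry; case: (sgrP (b x)) bx0; rewrite ?eqxx//= => _ _;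
      rewrite ?mul1e ?mulN1e; case: B => [r| |] /=; rewrite leey.
  (* Here 0 * +oo = 0 leaves only the second term, and [m] lies between 0 and [b y] for y in [G]. *)
  rewrite [in leRHS]bx0 mul0e sub0e abseN; apply: (sepE b) => //.
  - by case: bm => bm; [left|right] => y /bm; rewrite bx0; lra.
  - move=> y Gy; rewrite bx0 sub0r normrN.
    case: bm => /(_ y Gy); rewrite bx0 => /andP[? ?].
      by rewrite !ler0_norm ?lerN2 //; lra.
    by rewrite !ger0_norm //; lra.
have [Bfin|Binf] := boolP (B \is a fin_num); last first.
  rewrite -(fineK Afin) -EFinM.
  by case: B Binf => [r| |] //= _; rewrite leey.
have iA : leb.-integrable setT (EFin \o (fun y => \1_G y * ker x y)).
  apply/integrableP; split; first exact/measurable_EFinP.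
  by rewrite integral_fin_num_abs.
have iB : leb.-integrable setT (EFin \o (fun y => b y * \1_G y * ker x y)).
  apply/integrableP; split; first exact/measurable_EFinP.
  by rewrite integral_fin_num_abs.
rewrite (_ : _ - _ = \int[leb]_y ((b x - b y) * \1_G y * ker x y)%:E)%E.
  apply: (sepE (fun y => b x - b y)); first exact: measurable_funB.
  - by case: bm => bm; [right|left] => y /bm; lra.
  - move=> y Gy; case: bm => /(_ y Gy) /andP[? ?].
      by rewrite !ger0_norm; lra.
    by rewrite !ler0_norm; lra.
rewrite /A -integralZl// /B -integralB//=; last exact: integrableZl.
apply: eq_integral => y _; rewrite -EFinM -EFinB -/(ker x y).
by congr EFin; ring.
Qed.

End commutator_lower_bound.

(** * Inequalities of Hoelder and Jensen on a set, and deviation from the mean *)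

Section hoelder_on_sets.
Context d (T : measurableType d) (R : realType).
Variables (mu : {measure set T -> \bar R}) (D : set T).
Hypothesis mD : measurable D.
Local Open Scope ereal_scope.

Lemma ge0_hoelder_on (f g : T -> R) (p q : R) :
  measurable_fun setT f -> measurable_fun setT g ->
  (forall x, (0 <= f x)%R) -> (forall x, (0 <= g x)%R) ->
  (0 < p)%R -> (0 < q)%R -> (p^-1 + q^-1 = 1)%R ->
  \int[mu]_(x in D) (f x * g x)%:E <=
  (\int[mu]_(x in D) (f x `^ p)%:E) `^ p^-1 *
  (\int[mu]_(x in D) (g x `^ q)%:E) `^ q^-1.
Proof.
move=> mf mg f0 g0 p0 q0 pq.
have mD1 : measurable_fun setT (\1_D : T -> R) by exact: measurable_indic.
have NE (h : T -> R) (r : R) : (forall x, (0 <= h x)%R) -> (0 < r)%R ->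
    'N[mu]_r%:E[EFin \o (h \* \1_D)%R] =
    (\int[mu]_(x in D) (h x `^ r)%:E) `^ r^-1.
  move=> h0 r0; rewrite unlock; apply: (congr1 (poweR ^~ _)).
  rewrite [RHS]integral_mkcond.
  apply: eq_integral => x _; rewrite /= patchE indicE.
  case: (x \in D); rewrite ?mulr1 ?mulr0 ?normr0 ?powR0 ?gt_eqF//.
  by rewrite ger0_norm.
rewrite -!NE//; apply: le_trans; last first.
  by apply: hoelder => //; exact: measurable_funM.
rewrite Lnorm1 integral_mkcond le_eqVlt; apply/orP; left; apply/eqP.
apply: eq_integral => x _; rewrite /= patchE indicE.
case: (x \in D); rewrite ?mulr1 ?mulr0 ?normr0//.
by rewrite ger0_norm// mulr_ge0.
Qed.

(** Hoelder's inequality for the factorization of [h] into h w and 1 / w, valid almost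
    everywhere. *)
Lemma weighted_hoelder (p : R) (w h : T -> R) : (1 < p)%R ->
  measurable_fun setT w -> {ae mu, forall x, (0 < w x)%R} ->
  measurable_fun setT h -> (forall x, (0 <= h x)%R) ->
  \int[mu]_(x in D) (h x)%:E <=
  (\int[mu]_(x in D) (h x `^ p * w x `^ p)%:E) `^ p^-1 *
  (\int[mu]_(x in D) (w x `^ (- (p / (p - 1))))%:E) `^ (p / (p - 1))^-1.
Proof.
move=> p1 mw w0 mh h0; set p' := (p / (p - 1))%R.
have p0 : (0 < p)%R by lra.
have p10 : (0 < p - 1)%R by lra.
have p'0 : (0 < p')%R by rewrite divr_gt0.
have pp' : (p^-1 + p'^-1 = 1)%R.
  by rewrite /p' invf_div; field; apply/eqP; lra.
have mwr (r : R) : measurable_fun setT (fun x => w x `^ r)%R.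
  exact: (measurableT_comp (measurable_powR _)).
have mhw : measurable_fun setT (fun x => h x * w x `^ 1)%R.
  exact: measurable_funM.
(* The exponent 1 makes the factor nonnegative everywhere, whereas [w] is positive only almost
   everywhere. *)
have := @ge0_hoelder_on (fun x => h x * w x `^ 1)%R (fun x => w x `^ (-1))%R p p'.
have -> : \int[mu]_(x in D) ((h x * w x `^ 1) `^ p)%:E =
    \int[mu]_(x in D) (h x `^ p * w x `^ p)%:E.
  by apply: eq_integral => x _; rewrite powRM ?powR_ge0// -powRrM mul1r.
have -> : \int[mu]_(x in D) ((w x `^ (-1)) `^ p')%:E =
    \int[mu]_(x in D) (w x `^ (- p'))%:E.
  by apply: eq_integral => x _; rewrite -powRrM mulN1r.
have -> : \int[mu]_(x in D) (h x * w x `^ 1 * w x `^ (-1))%:E =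
    \int[mu]_(x in D) (h x)%:E.
  apply: ge0_ae_eq_integral => //.
  - by apply/measurable_EFinP; apply: measurable_funTS; exact: measurable_funM.
  - by apply/measurable_EFinP; exact: measurable_funTS.
  - by move=> x _; rewrite lee_fin !mulr_ge0 ?powR_ge0.
  - by move=> x _; rewrite lee_fin.
  - by apply: filterS w0 => x wx _; rewrite powRN mulfK// gt_eqF// powR_gt0.
by apply => // x; rewrite ?mulr_ge0 ?powR_ge0.
Qed.

(** Jensen's inequality without normalization: Hoelder for w^p against 1 with exponents q/p and
    q/(q-p), followed by a p-th root. *)
Lemma integral_powR_le (p q : R) (w : T -> R) : (0 < p < q)%R ->
  measurable_fun setT w ->
  (\int[mu]_(x in D) (w x `^ p)%:E) `^ p^-1 <=
  (\int[mu]_(x in D) (w x `^ q)%:E) `^ q^-1 * mu D `^ (p^-1 - q^-1).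
Proof.
move=> /andP[p0 pq] mw.
have q0 : (0 < q)%R by lra.
have qp0 : (0 < q - p)%R by lra.
have mwp : measurable_fun setT (fun x => w x `^ p)%R.
  exact: (measurableT_comp (measurable_powR _)).
have := @ge0_hoelder_on (fun x => w x `^ p)%R (fun=> 1%R) (q / p) (q / (q - p)).
move=> /(_ mwp (measurable_cst _)).
rewrite !divr_gt0// => /(_ (fun x => powR_ge0 _ _) (fun x => ler01) isT isT).
have -> : ((q / p)^-1 + (q / (q - p))^-1 = 1)%R.
  by rewrite !invf_div; field; rewrite gt_eqF.
move=> /(_ erefl).
under eq_integral do rewrite mulr1.
under [X in _ <= X `^ _ * _ -> _]eq_integral do
  rewrite -powRrM mulrCA divff ?gt_eqF// mulr1.
under [X in _ <= _ * X `^ _ -> _]eq_integral do rewrite powR1.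
rewrite integral_cst// mul1e => H.
apply: (le_trans (lee_poweR _ _ H)); first by rewrite invr_ge0 ltW.
  by apply: integral_ge0 => x _; rewrite lee_fin powR_ge0.
rewrite poweRM ?poweR_ge0// -!poweRrM !invf_div.
rewrite (_ : p / q * p^-1 = q^-1)%R; last by field; rewrite !gt_eqF.
by rewrite (_ : (q - p) / q * p^-1 = p^-1 - q^-1)%R//; field; rewrite !gt_eqF.
Qed.

End hoelder_on_sets.

(** Since [b - c] has integral zero, its positive and negative parts have the same integral, each
    half of that of the modulus. *)
Lemma integral_deviation d (T : measurableType d) (R : realType)
    (mu : {measure set T -> \bar R}) (D : set T) (b : T -> R) (c : R) :
  measurable D -> mu.-integrable D (EFin \o b) -> (mu D < +oo)%E ->
  (\int[mu]_(x in D) (b x)%:E = c%:E * mu D)%E ->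
  (\int[mu]_(x in D) `|(b x - c)%:E| =
     2%:E * \int[mu]_(x in D) (Num.max (b x - c) 0)%:E)%E /\
  (\int[mu]_(x in D) `|(b x - c)%:E| =
     2%:E * \int[mu]_(x in D) (Num.max (c - b x) 0)%:E)%E.
Proof.
move=> mD ib Dfin bc.
pose g x := (b x - c)%:E.
have ic : mu.-integrable D (EFin \o cst c).
  apply/integrableP; split; first exact/measurable_EFinP.
  by have /= -> := integral_cst mu mD `|c%:E|; rewrite lte_mul_pinfty.
have ig : mu.-integrable D g.
  by rewrite (_ : g = (EFin \o b) \- (EFin \o cst c))%E//; exact: integrableB.
have g0 : (\int[mu]_(x in D) g x = 0)%E.
  rewrite /g; under eq_integral do rewrite EFinB.
  rewrite integralB_EFin//= bc integral_cst// subee// fin_numM//.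
  by rewrite ge0_fin_numE.
have posE : (\int[mu]_(x in D) (Num.max (b x - c) 0)%:E =
    \int[mu]_(x in D) g^\+ x)%E.
  by apply: eq_integral => x _; rewrite funeposE /g EFin_max.
have negE : (\int[mu]_(x in D) (Num.max (c - b x) 0)%:E =
    \int[mu]_(x in D) g^\- x)%E.
  by apply: eq_integral => x _; rewrite funenegE /g EFin_max -EFinN opprB.
have pn : (\int[mu]_(x in D) g^\+ x = \int[mu]_(x in D) g^\- x)%E.
  have := integralE mu D g; rewrite g0 => /esym/eqP.
  by rewrite sube_eq ?add0e ?fin_num_adde_defr ?integrable_pos_fin_num// => /eqP.
have mg : measurable_fun D g by exact: measurable_int ig.
have absE : (\int[mu]_(x in D) `|g x| =
    \int[mu]_(x in D) g^\+ x + \int[mu]_(x in D) g^\- x)%E.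
  rewrite -ge0_integralD//; [|exact: measurable_funepos|exact: measurable_funeneg].
  by apply: eq_integral => x _; rewrite -[LHS]/((abse \o g) x) fune_abse.
rewrite posE negE; split; rewrite absE pn.
  by rewrite [in RHS](_ : 2%:E = 1 + 1)%E// ge0_muleDl ?mul1e.
by rewrite [in RHS](_ : 2%:E = 1 + 1)%E// ge0_muleDl ?mul1e.
Qed.

(** * Averages over cubes and the Muckenhoupt-type constant *)

Section cube_averages.
Variables (R : realType) (d : nat).
Local Open Scope ereal_scope.

Lemma cube_measure (Q : set (euclid R d)) : cube Q ->
  measurable Q /\ exists2 L : R, (0 < L)%R & leb Q = L%:E.
Proof.
move=> [a [l [l0 ->]]]; have [mQ lQ] := leb_cube a l0.
by split => //; exists (l ^+ d)%R => //; exact: exprn_gt0.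
Qed.

Lemma integral_avg (Q : set (euclid R d)) (f : euclid R d -> \bar R) : cube Q ->
  \int[leb]_(x in Q) f x = leb Q * avg Q f.
Proof.
move=> /cube_measure[_ [L L0 LQ]].
by rewrite /avg LQ /= muleA -EFinM divff ?gt_eqF// mul1e.
Qed.

Lemma avg_ge0 (Q : set (euclid R d)) (f : euclid R d -> \bar R) :
  (forall x, 0 <= f x) -> 0 <= avg Q f.
Proof.
move=> f0; rewrite mule_ge0 ?integral_ge0//.
by rewrite lee_fin invr_ge0 fine_ge0.
Qed.

Lemma Apq_cube (p q : R) (w : euclid R d -> R) (Q : set (euclid R d)) :
  (1 < p < q)%R -> measurable_fun setT w -> cube Q ->
  (\int[leb]_(x in Q) (w x `^ p)%:E) `^ p^-1 *
  (\int[leb]_(x in Q) (w x `^ (- (p / (p - 1))))%:E) `^ (p / (p - 1))^-1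
  <= leb Q * Apq_const p q w.
Proof.
move=> /andP[p1 pq] mw cQ; have [mQ [L L0 LQ]] := cube_measure cQ.
set p' := (p / (p - 1))%R.
pose A r : \bar R := avg Q (fun x => (w x `^ r)%:E).
have A0 r : 0 <= A r by apply: avg_ge0 => x; rewrite lee_fin powR_ge0.
have L0' : 0 <= L%:E by rewrite lee_fin ltW.
apply: (@le_trans _ _ (leb Q * (A q `^ q^-1 * A (- p')%R `^ p'^-1))); last first.
  rewrite LQ lee_wpmul2l//; apply: ereal_sup_ubound.
  by exists Q.
have := @integral_powR_le _ _ _ leb Q mQ p q w.
rewrite pq (lt_trans ltr01 p1) => /(_ isT mw) H.
apply: (le_trans (lee_wpmul2r (poweR_ge0 _ _) H)).
rewrite !(integral_avg _ cQ) -/(A q) -/(A (- p')%R) /= LQ.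
rewrite (poweRM _ L0' (A0 q)) (poweRM _ L0' (A0 _)).
rewrite !poweR_EFin.
(* The powers of the measure of Q produced by Jensen and by the two averages add up to 1/q + (1/p -
   1/q) + 1/p' = 1. *)
rewrite (_ : L%:E = (L `^ q^-1 * L `^ (p^-1 - q^-1) * L `^ p'^-1)%:E); last first.
  congr EFin; rewrite -!powRD ?(gt_eqF L0) ?implybT//.
  rewrite (_ : _ + _ = 1)%R ?powRr1 ?ltW//.
  have [p0 p10 q0] : [/\ 0 < p, 0 < p - 1 & 0 < q]%R by split; lra.
  by rewrite /p' invf_div; field; rewrite !gt_eqF.
by rewrite !EFinM [leRHS]muleACA [in leRHS](muleAC _ _ (A q `^ _)).
Qed.

End cube_averages.

(** * Testing the commutator bound on a fixed cube *)

Section testing.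
Variables (R : realType) (d : nat) (alpha p q t : R).
Hypotheses (halpha : 0 < alpha < d%:R) (hpq : 1 < p < q) (ht : t = d%:R / alpha).
Variables (w b : euclid R d -> R) (C0 : R).
Hypotheses (hw : weight w) (hb : loc_integrable b) (C00 : 0 < C0).
Hypothesis commutator_bound : forall v f : euclid R d -> R,
  (forall x, 0 <= v x) -> weakL t v -> bounded_compactly_supported f ->
  (weighted_norm p (fun x => (w x * v x) `^ p)%R (riesz_commutator alpha b f)
   <= C0%:E * weakL_norm t v
        * weighted_norm p (fun x => w x `^ p)%R (EFin \o f))%E.
Variables (a : euclid R d) (l : R).
Hypothesis l0 : 0 < l.

Let Q := [set x : euclid R d | forall i, a ord0 i <= x ord0 i <= a ord0 i + l].

Let cQ : cube Q.
Proof. by exists a, l. Qed.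

Let mQ : measurable Q.
Proof. by have [] := leb_cube a l0. Qed.

Let lebQ : leb Q = (l ^+ d)%:E.
Proof. by have [] := leb_cube a l0. Qed.

Let d0 : (0 < d)%N.
Proof. by case/andP: halpha => a0 ad; rewrite -(ltr0n R); lra. Qed.

Local Open Scope ereal_scope.

Let weakL_cube : weakL_norm t (\1_Q : euclid R d -> R) <= (l `^ alpha)%:E.
Proof.
have /andP[al0 ald] := halpha.
have ad : (0 < d%:R :> R)%R by lra.
apply: (le_trans (weakL_norm_indic _ _)); first by rewrite ht divr_gt0.
rewrite lebQ poweR_EFin lee_fin -powR_mulrn ?(ltW l0)// -powRrM.
by rewrite ht invf_div mulrCA divff ?mulr1// gt_eqF.
Qed.

Let supported_in_cube (G : set (euclid R d)) : measurable G -> G `<=` Q ->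
  bounded_compactly_supported (\1_G : euclid R d -> R).
Proof.
move=> mG GQ; split; first exact: measurable_indic.
  by exists 1%R => x; rewrite indicE; case: (x \in G); rewrite ?normr1 ?normr0.
apply: (subclosed_compact _ (compact_cube cQ)); first exact: closed_closure.
rewrite [X in _ `<=` X](closure_id Q).1; last exact: closed_cube.
apply: closure_subset => x /=; rewrite indicE.
by case: (boolP (x \in G)) => [/set_mem /GQ//|_]; rewrite eqxx.
Qed.

(** The hypothesis with v = [\1_Q] and f = [\1_G] controls the weighted norm [X] of [h] by that of
    the indicator of Q; weighted Hoelder then returns to the plain integral, and [Apq_cube] absorbs
    both weight factors. *)
Lemma testing_bound (G : set (euclid R d)) (h : euclid R d -> R) (k : R) :
  measurable G -> G `<=` Q -> measurable_fun setT h ->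
  (forall x, 0 <= h x)%R -> (0 < k)%R ->
  (forall x, Q x -> (k * h x)%:E <= `|riesz_commutator alpha b \1_G x|) ->
  \int[leb]_(x in Q) (h x)%:E <=
  (k^-1 * (C0 * l `^ alpha))%:E * (leb Q * Apq_const p q w).
Proof.
move=> mG GQ mh h0 k0 kh; have [mw w0] := hw.
have /andP[p1 _] := hpq.
have p0 : (0 < p)%R by lra.
have p0' := ltW p0.
have mwr (r : R) : measurable_fun setT (fun x => w x `^ r)%R.
  exact: (measurableT_comp (measurable_powR _)).
have mhp : measurable_fun setT (fun x => h x `^ p * w x `^ p)%R.
  apply: measurable_funM; last exact: mwr.
  exact: (measurableT_comp (measurable_powR _)).
have wv : weakL t (\1_Q : euclid R d -> R).
  split; first exact: measurable_indic.
  exact: le_lt_trans weakL_cube (ltry _).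
have v0 x : (0 <= (\1_Q : euclid R d -> R) x)%R by [].
have := commutator_bound v0 wv (supported_in_cube mG GQ).
set N := weighted_norm _ _ _ => H.
set X := (\int[leb]_(x in Q) (h x `^ p * w x `^ p)%:E) `^ p^-1.
set Y := (\int[leb]_(x in Q) (w x `^ p)%:E) `^ p^-1.
have kX : k%:E * X <= N.
  have I0 : 0 <= \int[leb]_(x in Q) (h x `^ p * w x `^ p)%:E.
    by apply: integral_ge0 => x _; rewrite lee_fin mulr_ge0 ?powR_ge0.
  have -> : k%:E = (k `^ p)%:E `^ p^-1.
    by rewrite poweR_EFin -powRrM divff ?gt_eqF// powRr1// ltW.
  rewrite -poweRM ?lee_fin ?powR_ge0//; apply: lee_poweR.
  - by rewrite invr_ge0 ltW.
  - by rewrite mule_ge0// lee_fin powR_ge0.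
  rewrite -ge0_integralZl_EFin; [|exact: mQ| | |exact: powR_ge0]; last 2 first.
  - by move=> x _; rewrite lee_fin mulr_ge0 ?powR_ge0.
  - by apply/measurable_EFinP; exact: measurable_funTS.
  rewrite integral_mkcond; apply: ge0_integral_mono => x; rewrite patchE.
    by case: ifP => // _; rewrite -EFinM lee_fin !mulr_ge0 ?powR_ge0.
  case: ifPn => [/set_mem Qx|_]; last first.
    by rewrite mule_ge0 ?poweR_ge0 ?lee_fin ?powR_ge0.
  rewrite indicE mem_set// mulr1 -EFinM mulrA -powRM ?(ltW k0)// EFinM.
  rewrite lee_wpmul2r ?lee_fin ?powR_ge0// -poweR_EFin lee_poweR ?kh//.
  by rewrite lee_fin mulr_ge0// ltW.
(* Enlarging [G] to Q puts both weight integrals over the same cube. *)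
have GY : weighted_norm p (fun x => w x `^ p)%R (EFin \o \1_G) <= Y.
  apply: lee_poweR; first by rewrite invr_ge0 ltW.
    by apply: integral_ge0 => x _; rewrite mule_ge0 ?poweR_ge0 ?lee_fin ?powR_ge0.
  rewrite [leRHS]integral_mkcond; apply: ge0_integral_mono => x.
    by rewrite mule_ge0 ?poweR_ge0 ?lee_fin ?powR_ge0.
  rewrite patchE /= indicE; have [/set_mem/GQ Qx|_] := boolP (x \in G).
    by rewrite mem_set// normr1 powR1 mul1e.
  rewrite normr0 powR0 ?gt_eqF// mul0e; case: ifP => // _.
  by rewrite lee_fin powR_ge0.
have XY : X <= (k^-1 * (C0 * l `^ alpha))%:E * Y.
  rewrite EFinM -muleA lee_pdivlMl//; apply: (le_trans kX); apply: (le_trans H).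
  rewrite EFinM; apply: lee_pmul; last exact: GY.
  - by rewrite mule_ge0 ?weakL_norm_ge0// lee_fin ltW.
  - exact: poweR_ge0.
  - by rewrite lee_wpmul2l// lee_fin ltW.
apply: (le_trans (weighted_hoelder mQ p1 mw w0 mh h0)).
apply: (le_trans (lee_wpmul2r (poweR_ge0 _ _) XY)).
rewrite -muleA; apply: lee_wpmul2l; last exact: Apq_cube.
by rewrite lee_fin !mulr_ge0 ?invr_ge0 ?powR_ge0// ltW.
Qed.

Let K : R := (Num.sqrt d%:R `^ (d%:R - alpha))%R.

(** The conditions on [h] fit both truncations of [b - c], so the two choices of the large half [G]
    share one proof. *)
Let half_oscillation (G : set (euclid R d)) (h : euclid R d -> R) (c : R) :
  measurable G -> G `<=` Q -> (l ^+ d / 2)%:E <= leb G ->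
  measurable_fun setT h -> (forall x, 0 <= h x)%R ->
  (forall x, Q x -> h x = 0%R \/ h x = `|b x - c|%R /\
    ((forall y, G y -> b y <= c <= b x)%R \/
     (forall y, G y -> b x <= c <= b y)%R)) ->
  \int[leb]_(x in Q) (h x)%:E <= (2 * K * C0)%:E * (leb Q * Apq_const p q w).
Proof.
move=> mG GQ Ghalf mh h0 hbc; have /andP[_ ad] := halpha.
have d0' : (0 < d%:R :> R)%R by rewrite ltr0n.
have L0 : (0 < l ^+ d)%R by exact: exprn_gt0.
have sd0 : (0 < Num.sqrt d%:R :> R)%R by rewrite sqrtr_gt0.
pose kappa : R := ((Num.sqrt d%:R * l) `^ (d%:R - alpha))^-1%R.
have kappa0 : (0 < kappa)%R by rewrite invr_gt0 powR_gt0// mulr_gt0.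
pose k : R := (kappa * (l ^+ d / 2))%R.
have k0 : (0 < k)%R by rewrite mulr_gt0// divr_gt0.
(* The inverse of [k] is 2 K l^(d - alpha) / l^d = 2 K l^(- alpha), so the side length cancels. *)
have -> : (2 * K * C0 = k^-1 * (C0 * l `^ alpha))%R.
  have lE : (l ^+ d = l `^ (d%:R - alpha) * l `^ alpha)%R.
    by rewrite -powRD ?(gt_eqF l0) ?implybT// subrK powR_mulrn// ltW.
  rewrite /k /kappa powRM ?ltW// -/K lE; field.
  by rewrite !gt_eqF ?powR_gt0.
apply: (testing_bound mG GQ mh h0 k0) => x Qx.
have [->|[-> bm]] := hbc x Qx; first by rewrite mulr0 abse_ge0.
have [mb _] := hb.
apply: le_trans (riesz_commutator_ge d0 ad l0 mb mG GQ Qx bm).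
rewrite -/kappa /k mulrAC EFinM lee_wpmul2l// lee_fin mulr_ge0//.
exact: ltW.
Qed.

Lemma oscillation_bound :
  avg Q (fun x => `|b x - fine (avg Q (EFin \o b))|%:E) <=
  (4 * K * C0)%:E * Apq_const p q w.
Proof.
have [mb hbK] := hb; set c := fine _.
have L0 : (0 < l ^+ d)%R by exact: exprn_gt0.
have ib : leb.-integrable Q (EFin \o b).
  apply/integrableP; split; last exact: hbK (compact_cube cQ).
  by apply/measurable_EFinP; exact: measurable_funTS.
have bc : \int[leb]_(x in Q) (b x)%:E = c%:E * leb Q.
  rewrite (integral_avg _ cQ) muleC fineK// /avg fin_numM//.
  exact: integrable_fin_num ib.
have Qfin : leb Q < +oo by rewrite lebQ ltry.
have [posE negE] := integral_deviation mQ ib Qfin bc.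
have mbc : measurable_fun setT (fun x => b x - c)%R by exact: measurable_funB.
have mcb : measurable_fun setT (fun x => c - b x)%R by exact: measurable_funB.
(* The constant 4 is a 2 from [integral_deviation] times a 2 from the half-measure of [G]. *)
suff [h hE hle] : exists2 h : euclid R d -> R,
    \int[leb]_(x in Q) `|(b x - c)%:E| = 2%:E * \int[leb]_(x in Q) (h x)%:E &
    \int[leb]_(x in Q) (h x)%:E <= (2 * K * C0)%:E * (leb Q * Apq_const p q w).
  rewrite /avg [X in _ * X]hE lebQ /= lee_pdivrMl//.
  apply: (@le_trans _ _ (2%:E * ((2 * K * C0)%:E * (leb Q * Apq_const p q w)))).
    by rewrite lee_wpmul2l.
  rewrite lebQ !muleA -!EFinM le_eqVlt; apply/orP; left; apply/eqP.
  by congr (EFin _ * _); ring.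
pose G1 := Q `&` [set x | (b x <= c)%R]; pose G2 := Q `&` [set x | (c <= b x)%R].
have mG1 : measurable G1.
  rewrite (_ : G1 = Q `&` b @^-1` `]-oo, c]%classic).
    by apply: (measurable_funTS mb) => //; exact: measurable_itv.
  by rewrite /G1 set_itvE.
have mG2 : measurable G2.
  rewrite (_ : G2 = Q `&` b @^-1` `[c, +oo[%classic).
    by apply: (measurable_funTS mb) => //; exact: measurable_itv.
  by rewrite /G2 set_itvE.
have [G1half|G1half] := leP (l ^+ d / 2)%:E (leb G1).
  exists (fun x => Num.max (b x - c) 0)%R; first exact: posE.
  apply: (half_oscillation (c := c) mG1 _ G1half) => [x []//| | |x Qx].
  - exact: measurable_maxr.
  - by move=> x; rewrite le_max lexx orbT.
  - have [bxc|cbx] := leP (b x) c; first by left; rewrite max_r// subr_le0.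
    right; have cbx' := ltW cbx.
    rewrite max_l ?subr_ge0// ger0_norm ?subr_ge0//; split=> [//|].
    by left => y [_ /= ->].
exists (fun x => Num.max (c - b x) 0)%R; first exact: negE.
(* [G1] and [G2] cover Q, so they cannot both have less than half of its measure. *)
have G2half : (l ^+ d / 2)%:E <= leb G2.
  rewrite leNgt; apply/negP => G2half.
  suff : leb Q < leb Q by rewrite ltxx.
  have QE : Q = G1 `|` G2.
    rewrite -setIUr; apply/seteqP; split => x; last by case.
    by move=> Qx; split => //=; exact/orP/le_total.
  apply: (@le_lt_trans _ _ (leb G1 + leb G2)).
    by rewrite [in leLHS]QE; exact: measureU2.
  by rewrite lebQ [X in X%:E](splitr (l ^+ d)) EFinD; exact: lteD.
apply: (half_oscillation (c := c) mG2 _ G2half) => [x []//| | |x Qx].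
- exact: measurable_maxr.
- by move=> x; rewrite le_max lexx orbT.
- have [cbx|bxc] := leP c (b x); first by left; rewrite max_r// subr_le0.
  right; have bxc' := ltW bxc.
  rewrite max_l ?subr_ge0// ler0_norm ?subr_le0// opprB; split=> [//|].
  by right => y [_ /= ->]; rewrite bxc'.
Qed.

End testing.

Theorem theorem5p5 (R : realType) (d : nat) (alpha p p_alpha t : R)
    (halpha : 0 < alpha < d%:R) (hp : 1 < p < d%:R / alpha)
    (hp_alpha : p_alpha^-1 = p^-1 - alpha / d%:R) (ht : t = d%:R / alpha) :
  exists C : R -> R,
  forall (w : euclid R d -> R), Apq p p_alpha w ->
  forall (b : euclid R d -> R), loc_integrable b ->
  forall C0 : R, 0 < C0 ->
  (forall v f : euclid R d -> R,
     (forall x, 0 <= v x) -> weakL t v -> bounded_compactly_supported f ->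
     (weighted_norm p (fun x => (w x * v x) `^ p)%R (riesz_commutator alpha b f)
      <= C0%:E * weakL_norm t v
           * weighted_norm p (fun x => w x `^ p)%R (EFin \o f))%E) ->
  bmo b /\ (bmo_norm b <= (C (fine (Apq_const p p_alpha w)) * C0)%:E)%E.
Proof.
exists (fun A => 4 * Num.sqrt d%:R `^ (d%:R - alpha) * A).
move=> w [hw Afin] b hb C0 C00 bound.
have /andP[a0 ad] := halpha; have /andP[p1 pd] := hp.
have d0 : 0 < d%:R :> R by exact: lt_trans ad.
have p0 : 0 < p by exact: lt_trans p1.
(* Positivity of [alpha / d] gives the order of the inverses, and [p < d / alpha] makes [p_alpha]
   positive, so that the order can be inverted. *)
have hpq : 1 < p < p_alpha.
  have ip : p_alpha^-1 < p^-1 by rewrite hp_alpha ltrBlDr ltrDl divr_gt0.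
  have q0 : 0 < p_alpha.
    rewrite -invr_gt0 hp_alpha subr_gt0 -[ltLHS]invf_div ltf_pV2 ?posrE//.
    exact: divr_gt0.
  by rewrite p1 -ltf_pV2 ?posrE.
(* Tested on the unit cube; with finiteness it ensures that [fine] preserves the constant. *)
have A0 : (0 <= Apq_const p p_alpha w)%E.
  pose Q := [set x : euclid R d | forall i,
    (0 : 'rV[R]_d) ord0 i <= x ord0 i <= (0 : 'rV[R]_d) ord0 i + 1].
  have cQ : cube Q by exists 0, 1.
  rewrite /Apq_const.
  apply: le_trans (ereal_sup_ubound (ex_intro2 _ _ Q cQ erefl)).
  by rewrite mule_ge0 ?poweR_ge0.
have osc : (bmo_norm b <=
    (4 * Num.sqrt d%:R `^ (d%:R - alpha) * C0)%:E * Apq_const p p_alpha w)%E.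
  apply: ge_ereal_sup => _ [Q [a [l [l0 ->]]] <-].
  exact: (oscillation_bound halpha hpq ht hw hb C00 bound a l0).
have osc' : (bmo_norm b <= (4 * Num.sqrt d%:R `^ (d%:R - alpha) *
    fine (Apq_const p p_alpha w) * C0)%:E)%E.
  by rewrite mulrAC EFinM fineK// ge0_fin_numE.
by split=> //; split=> //; exact: le_lt_trans osc' (ltry _).
Qed.
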